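(* Let $k$ be a field, let $F$ be a free group on a finite alphabet $A$, and let $kF$ be its group algebra over $k$. Suppose that $\mathbf{u}\in kF\setminus k$ is supported on a cyclic group. Then the centralizer of $\mathbf{u}$ in $kF$ is of the form $kZ$, where $Z$ is the largest cyclic subgroup of $F$ supporting $\mathbf{u}$ (i.e. the largest cyclic subgroup of $F$ containing $\mathrm{Supp}(\mathbf{u})$).
   Context: For $\mathbf{u}=\sum_{g\in F}a_g g\in kF$, the support is $\mathrm{Supp}(\mathbf{u})=\{g\in F:a_g\neq 0\}$. An element of $kF$ is said to be supported on a cyclic group if its support is contained in a cyclic subgroup of $F$. The field $k$ is regarded as a subset of $kF$ via scalar multiples of the identity. For a subgroup $Z\le F$, $kZ\subseteq kF$ denotes the group algebra of $Z$, i.e. the $k$-span of $Z$. The centralizer of $\mathbf{u}$ in $kF$ is $\{\mathbf{v}\in kF:\mathbf{u}\mathbf{v}=\mathbf{v}\mathbf{u}\}$. *)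

(* Defs.v *)
From HB Require Import structures.
From mathcomp Require Import all_boot all_order all_algebra finmap.
From mathcomp Require Import boolp classical_sets.
From mathcomp Require Import monalg.

Set Implicit Arguments.
Unset Strict Implicit.
Unset Printing Implicit Defensive.

Import GRing.Theory.

Local Open Scope classical_set_scope.

(* A letter (a, false) stands for the generator a, and (a, true) for its
   formal inverse. *)
Definition letter (A : Type) : Type := (A * bool)%type.

Definition letter_inv (A : Type) (l : letter A) : letter A := (l.1, ~~ l.2).

Lemma letter_invK (A : Type) : involutive (@letter_inv A).
Proof. by case=> a b; rewrite /letter_inv /= negbK. Qed.

Definition reduced (A : eqType) (w : seq (letter A)) : bool :=
  sorted (fun l m => m != letter_inv l) w.

Definition free_group (A : choiceType) : Type :=
  {w : seq (letter A) | reduced w}.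

HB.instance Definition _ (A : choiceType) := Choice.on (free_group A).
HB.instance Definition _ (A : choiceType) := SubType.on (free_group A).

Section FreeGroup.
Variable A : choiceType.
Implicit Types (l m : letter A) (v w : seq (letter A)) (x y z : free_group A).

Definition push l w : seq (letter A) :=
  if w is m :: w' then (if m == letter_inv l then w' else l :: w) else [:: l].

Definition reduce w : seq (letter A) := foldr push [::] w.

Lemma reduced_push l w : reduced w -> reduced (push l w).
Proof.
case: w => [//|m w] rw /=; case: ifPn => [_|ne]; first exact: path_sorted rw.
by rewrite /reduced /= ne.
Qed.

Lemma pushK l w : reduced w -> push (letter_inv l) (push l w) = w.
Proof.
case: w => [_|m w] /=; first by rewrite letter_invK eqxx.
case: eqVneq => [->|ne] /= rw; last by rewrite letter_invK eqxx.
case: w rw => [//|p w] /= /andP[ne _].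
by rewrite (negbTE ne).
Qed.

Lemma pushVK l w : reduced w -> push l (push (letter_inv l) w) = w.
Proof. by move=> rw; rewrite -{1}(letter_invK l) pushK. Qed.

Lemma reduced_foldr v w : reduced w -> reduced (foldr push w v).
Proof. by move=> rw; elim: v => //= l v; apply: reduced_push. Qed.

Lemma reduced_reduce w : reduced (reduce w).
Proof. exact: reduced_foldr. Qed.

Lemma reduce_id w : reduced w -> reduce w = w.
Proof.
elim: w => //= l w IHw rw; rewrite -/(reduce w) IHw; last exact: path_sorted rw.
by case: w rw {IHw} => //= m w /andP[/negbTE-> _].
Qed.

Lemma foldr_push l v w : reduced w ->
  foldr push w (push l v) = push l (foldr push w v).
Proof.
move=> rw; case: v => [//|m v] /=; case: eqVneq => [->|//].
by rewrite pushVK // reduced_foldr.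
Qed.

Lemma foldr_reduce v w : reduced w -> foldr push w (reduce v) = foldr push w v.
Proof. by move=> rw; elim: v => //= l v <-; rewrite foldr_push. Qed.

Lemma reduce_cat v w : reduce (v ++ w) = foldr push (reduce w) v.
Proof. by rewrite /reduce foldr_cat. Qed.

Lemma reduce_catl v w : reduce (reduce v ++ w) = reduce (v ++ w).
Proof. by rewrite !reduce_cat foldr_reduce // reduced_reduce. Qed.

Lemma reduce_catr v w : reduce (v ++ reduce w) = reduce (v ++ w).
Proof. by rewrite !reduce_cat reduce_id // reduced_reduce. Qed.

Definition fgrp_of_word w : free_group A := Sub (reduce w) (reduced_reduce w).

Definition word_inv w : seq (letter A) := rev (map (@letter_inv A) w).

Lemma reduce_invl w : reduce (word_inv w ++ w) = [::].
Proof.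
elim: w => //= l w IHw; rewrite /word_inv /= rev_cons -cats1 -catA /=.
rewrite -reduce_catr /= -/(reduce _) /=.
by rewrite pushK ?reduced_reduce // reduce_catr.
Qed.

Lemma word_invK : involutive word_inv.
Proof.
by move=> w; rewrite /word_inv map_rev revK mapK //; apply: letter_invK.
Qed.

Definition fgrp_one : free_group A := fgrp_of_word [::].
Definition fgrp_mul x y : free_group A := fgrp_of_word (val x ++ val y).
Definition fgrp_inv x : free_group A := fgrp_of_word (word_inv (val x)).

Lemma fgrp_mulA : associative fgrp_mul.
Proof.
by move=> x y z; apply: val_inj; rewrite /= reduce_catl reduce_catr catA.
Qed.

Lemma fgrp_mul1 : left_id fgrp_one fgrp_mul.
Proof. by move=> x; apply: val_inj; rewrite /= reduce_id //; case: x. Qed.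

Lemma fgrp_mulg1 : right_id fgrp_one fgrp_mul.
Proof. by move=> x; apply: val_inj; rewrite /= cats0 reduce_id //; case: x. Qed.

Lemma fgrp_mulV : left_inverse fgrp_one fgrp_inv fgrp_mul.
Proof. by move=> x; apply: val_inj; rewrite /= reduce_catl reduce_invl. Qed.

Lemma fgrp_mulgV : right_inverse fgrp_one fgrp_inv fgrp_mul.
Proof.
move=> x; apply: val_inj; rewrite /= reduce_catr.
by rewrite -{1}(word_invK (val x)) reduce_invl.
Qed.

HB.instance Definition _ := isGroup.Build (free_group A)
  fgrp_mulA fgrp_mul1 fgrp_mulg1 fgrp_mulV fgrp_mulgV.

Definition fgrp_gen (a : A) : free_group A := fgrp_of_word [:: (a, false)].

End FreeGroup.

Section Universal.
Variables (A : choiceType) (G : groupType) (f : A -> G).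
Local Open Scope group_scope.

Let ev (l : letter A) : G := if l.2 then (f l.1)^-1 else f l.1.

Definition fgrp_lift (x : free_group A) : G :=
  foldr (fun l g => ev l * g) 1 (val x).

Let lift (w : seq (letter A)) : G := foldr (fun l g => ev l * g) 1 w.

Let evV l : ev (letter_inv l) = (ev l)^-1.
Proof. by case: l => a []; rewrite /ev /= ?invgK. Qed.

Let lift_push l w : lift (push l w) = ev l * lift w.
Proof. by case: w => //= m w; case: eqP => //= ->; rewrite evV mulVKg. Qed.

Let lift_reduce w : lift (reduce w) = lift w.
Proof. by elim: w => //= l w IHw; rewrite lift_push IHw. Qed.

Let lift_cat v w : lift (v ++ w) = lift v * lift w.
Proof. by elim: v => [|l v IHv] /=; rewrite ?mul1g // IHv mulgA. Qed.

Lemma fgrp_liftM : {morph fgrp_lift : x y / x * y}.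
Proof. by move=> x y; rewrite [LHS]lift_reduce lift_cat. Qed.

Lemma fgrp_lift_gen a : fgrp_lift (fgrp_gen a) = f a.
Proof. by rewrite /fgrp_lift /= /ev mulg1. Qed.

Lemma fgrp_lift_unique (phi : free_group A -> G) :
  {morph phi : x y / x * y} -> (forall a, phi (fgrp_gen a) = f a) ->
  phi =1 fgrp_lift.
Proof.
move=> phiM phif.
have phi1 : phi 1 = 1.
  by apply: (@mulgI _ (phi 1)); rewrite -phiM !mulg1.
have phiV x : phi x^-1 = (phi x)^-1.
  by apply: (@mulgI _ (phi x)); rewrite -phiM !mulgV phi1.
have phil l : phi (fgrp_of_word [:: l]) = ev l.
  case: l => a []; rewrite /ev /= -phif // -phiV.
  by congr phi; apply: val_inj.
move=> x; rewrite -[x in LHS](_ : fgrp_of_word (val x) = x); last first.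
  by apply: val_inj; rewrite /= reduce_id //; case: x.
rewrite /fgrp_lift; elim: (val x) => [|l w IHw]; first exact: phi1.
rewrite /= -IHw -phil -phiM; congr phi; apply: val_inj => /=.
by rewrite [in RHS]reduce_id ?reduced_reduce.
Qed.

End Universal.

(* The finitely supported functions [{malg R[G]}] form an R-module for any
   choiceType [G], but the library only makes them a ring when [G] has no
   nontrivial invertible element, which excludes groups. *)
Definition group_algebra (R : nzRingType) (G : groupType) : Type :=
  {malg R[G]}.

Section GroupAlgebra.
Variables (R : comNzRingType) (G : groupType).
Local Open Scope ring_scope.
Local Notation kG := (group_algebra R G).

HB.instance Definition _ := GRing.Lmodule.copy kG {malg R[G]}.

Implicit Types (u v w : kG) (d : {fset G}).

Definition galg_mul u v : kG :=
  \sum_(g <- msupp u) \sum_(h <- msupp v) << u@_g * v@_h *g (g * h)%g >>.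

Lemma galg_mulEw d1 d2 u v : (msupp u `<=` d1)%fset -> (msupp v `<=` d2)%fset ->
  galg_mul u v =
  \sum_(g <- d1) \sum_(h <- d2) << u@_g * v@_h *g (g * h)%g >>.
Proof.
move=> le1 le2; rewrite /galg_mul (big_fset_incl _ le1) /=.
  apply/eq_bigr=> g _; apply/big_fset_incl => // h _ /mcoeff_outdom ->.
  by rewrite mulr0 monalgU0.
move=> g _ /mcoeff_outdom ug.
by rewrite big1 => // h _; rewrite ug mul0r monalgU0.
Qed.

Lemma galg_mulUU a b g h :
  galg_mul << a *g g >> << b *g h >> = << a * b *g (g * h)%g >>.
Proof. by rewrite (galg_mulEw msuppU_le msuppU_le) !big_seq_fset1 !mcoeffUU. Qed.

Lemma galg_mulDl : left_distributive galg_mul +%R.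
Proof.
move=> u v w; pose d := (msupp u `|` msupp v)%fset.
rewrite (@galg_mulEw d (msupp w)) ?(@galg_mulEw d (msupp w) u)
  ?(@galg_mulEw d (msupp w) v) ?fsubsetUl ?fsubsetUr ?msuppD_le //.
rewrite -big_split /=; apply/eq_bigr=> g _.
rewrite -big_split /=; apply/eq_bigr=> h _.
by rewrite mcoeffD mulrDl monalgUD.
Qed.

Lemma galg_mulDr : right_distributive galg_mul +%R.
Proof.
move=> w u v; pose d := (msupp u `|` msupp v)%fset.
rewrite (@galg_mulEw (msupp w) d) ?(@galg_mulEw (msupp w) d _ u)
  ?(@galg_mulEw (msupp w) d _ v) ?fsubsetUl ?fsubsetUr ?msuppD_le //.
rewrite -big_split /=; apply/eq_bigr=> g _.
rewrite -big_split /=; apply/eq_bigr=> h _.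
by rewrite mcoeffD mulrDr monalgUD.
Qed.

Lemma galg_mul0 : left_zero 0 galg_mul.
Proof. by move=> u; rewrite /galg_mul msupp0 big_seq_fset0. Qed.

Lemma galg_mulr0 : right_zero 0 galg_mul.
Proof.
by move=> u; rewrite /galg_mul big1 // => g _; rewrite msupp0 big_seq_fset0.
Qed.

Lemma galg_ind (P : kG -> Prop) :
  (forall a g, P << a *g g >>) -> (forall u v, P u -> P v -> P (u + v)) ->
  forall u, P u.
Proof.
move=> PU PD u; rewrite [u]monalgE.
elim/big_ind: _ => [|//|g _]; last exact: PU.
by rewrite -(monalgU0 (1%g : G)); apply: PU.
Qed.

Lemma galg_mulA : associative galg_mul.
Proof.
move=> u v w; elim/galg_ind: u => [a g|u u' IH IH']; last first.
  by rewrite !galg_mulDl IH IH'.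
elim/galg_ind: v => [b h|v v' IH IH']; last first.
  by rewrite !(galg_mulDl, galg_mulDr) IH IH'.
elim/galg_ind: w => [c i|w w' IH IH']; last first.
  by rewrite !galg_mulDr IH IH'.
by rewrite !galg_mulUU mulrA mulgA.
Qed.

Definition galg_one : kG := << 1%g >>.

Lemma galg_mul1 : left_id galg_one galg_mul.
Proof.
elim/galg_ind=> [a g|u v IH IH']; last by rewrite galg_mulDr IH IH'.
by rewrite galg_mulUU mul1r mul1g.
Qed.

Lemma galg_mulr1 : right_id galg_one galg_mul.
Proof.
elim/galg_ind=> [a g|u v IH IH']; last by rewrite galg_mulDl IH IH'.
by rewrite galg_mulUU mulr1 mulg1.
Qed.

Lemma galg_one_neq0 : galg_one != 0.
Proof. by rewrite monalgU_eq0 oner_eq0. Qed.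

HB.instance Definition _ := GRing.Zmodule_isNzRing.Build kG
  galg_mulA galg_mul1 galg_mulr1 galg_mulDl galg_mulDr galg_one_neq0.

Lemma galg_scaleU (a b : R) (g : G) :
  a *: (<< b *g g >> : kG) = << a * b *g g >>.
Proof.
by apply/malgP=> h; rewrite mcoeffZ !mcoeffU mulrnAr.
Qed.

Lemma galg_scaleAl (a : R) u v : a *: (u * v) = (a *: u) * v.
Proof.
elim/galg_ind: u => [b g|u u' IH IH']; last first.
  by rewrite mulrDl !scalerDr mulrDl IH IH'.
elim/galg_ind: v => [c h|v v' IH IH']; last first.
  by rewrite !mulrDr scalerDr IH IH'.
by rewrite galg_scaleU ![_ * _ : kG]galg_mulUU galg_scaleU mulrA.
Qed.

HB.instance Definition _ := GRing.Lmodule_isLalgebra.Build R kG galg_scaleAl.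

Lemma galg_scaleAr (a : R) u v : a *: (u * v) = u * (a *: v).
Proof.
elim/galg_ind: u => [b g|u u' IH IH']; last first.
  by rewrite !mulrDl scalerDr IH IH'.
elim/galg_ind: v => [c h|v v' IH IH']; last first.
  by rewrite mulrDr !scalerDr mulrDr IH IH'.
by rewrite galg_scaleU ![_ * _ : kG]galg_mulUU galg_scaleU mulrCA.
Qed.

HB.instance Definition _ := GRing.Lalgebra_isAlgebra.Build R kG galg_scaleAr.

Definition galg_supp u : set G := [set g | g \in msupp u].

Definition galg_scalars : set kG := range (fun c : R => c%:A : kG).

Definition galg_span (Z : set G) : set kG :=
  [set v | exists s : seq (R * G), (forall p, p \in s -> Z p.2) /\
     v = \sum_(p <- s) p.1 *: (<< p.2 >> : kG)].

End GroupAlgebra.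

Arguments galg_span R {G} Z _.

Definition centralizer (S : nzRingType) (x : S) : set S :=
  [set y | (x * y = y * x)%R].

Section Cyclic.
Variable G : groupType.
Local Open Scope group_scope.

Definition expgz (g : G) (n : int) : G :=
  match n with Posz m => g ^+ m | Negz m => g ^- m.+1 end.

Definition cyclic_subgroup (C : set G) : Prop := exists g, C = range (expgz g).

Definition largest_cyclic_containing (S Z : set G) : Prop :=
  [/\ cyclic_subgroup Z, S `<=` Z &
      forall C, cyclic_subgroup C -> S `<=` C -> C `<=` Z].

End Cyclic.

Definition supported_on_cyclic (R : comNzRingType) (G : groupType)
    (u : group_algebra R G) : Prop :=
  exists C, cyclic_subgroup C /\ galg_supp u `<=` C.

(* Main.v *)
Require Import Defs.
From HB Require Import structures.
From mathcomp Require Import all_boot all_order all_algebra finmap.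
From mathcomp Require Import boolp classical_sets.
From mathcomp Require Import monalg zify.

Set Implicit Arguments.
Unset Strict Implicit.
Unset Printing Implicit Defensive.

Import Order.TTheory GRing.Theory.

Local Open Scope classical_set_scope.

(** The statement is a fact about how a cyclic subgroup <z> sits in the free
    group F, combined with a leading-term argument in kF.

    Group theory. Let g be a nontrivial element of Supp(u).
    - The centralizer of g in F is cyclic, say <z>
      ([fgrp_centralizer_cyclic]). After conjugation the reduced word of g is
      cyclically reduced, and then, for y commuting with g, the word of y or
      that of its inverse commutes with the word of g without any cancellation
      ([cyc_reduced_join], [commute_val]). Words commuting with a given
      nonempty word are the powers of a single word ([commute_word_root]).
      Every cyclic group containing Supp(u) is abelian and contains g, so it
      lies in <z>: thus Z = <z>.
    - If z^i h z^j = h with i > 0, then h lies in <z>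
      ([conj_expgz_commute]). In other words <z> x <z> acts freely, by left and
      right translation, on the double coset of any h outside <z>. The equation
      says that h conjugates z^i to z^-j; the lengths of the powers of z grow
      linearly while conjugation changes lengths by a bounded amount, so
      |j| = i, and h or its square commutes with z^i.

    Ring theory. Suppose that v commutes with u and that Supp(v) is not
    contained in <z>. Replacing z by its inverse if need be, the largest
    exponent N of z in u is positive. Order F \ <z> by letting z^i h z^j lie
    above h whenever i > 0: by freeness this is a strict order, so the part of
    Supp(v) outside <z> has a maximal element h. At z^N h the product uv has
    the single nonzero contribution u(z^N) v(h), whereas vu has none, since
    z^N h z^-n is above h for every n ([centralizer_supp_pos]). Equivalently,
    (U(X) - U(Y)) P = 0 forces P = 0 for Laurent polynomials in two variables,
    which is what uv - vu = 0 says on each double coset.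

    The converse inclusion holds because <z> is abelian. *)

(** * Integer powers in a group *)

Section IntegerPowers.
Variable G : groupType.
Local Open Scope group_scope.
Implicit Types (x y z h : G) (m n : int).

Lemma expgzS z n : expgz z (n + 1)%R = z * expgz z n.
Proof.
case: n => [n|[|n]]; first by rewrite -PoszD addn1 /= expgS.
  by rewrite /= expg1 mulgV.
have -> : (Negz n.+1 + 1)%R = Negz n by rewrite !NegzE; lia.
by rewrite /= (expgSr z n.+1) invgM mulVKg.
Qed.

Lemma expgzD z m n : expgz z (m + n)%R = expgz z m * expgz z n.
Proof.
elim: m => [|m IH|m IH]; first by rewrite add0r mul1g.
  have -> : (m.+1%:Z + n = m%:Z + n + 1)%R by lia.
  by rewrite expgzS IH mulgA -[_ * expgz z m]expgS.
apply: (mulgI z); rewrite -expgzS mulgA -expgzS.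
have -> : (- m.+1%:Z + 1 = - m%:Z)%R by lia.
by rewrite -IH; congr expgz; lia.
Qed.

Lemma expgzN z n : expgz z (- n)%R = (expgz z n)^-1.
Proof. by apply/esym/mulg1_eq; rewrite -expgzD addrN. Qed.

Lemma expgzV z n : expgz z^-1 n = (expgz z n)^-1.
Proof. by case: n => n; rewrite /= ?expVgn // expVgn. Qed.

Lemma expgzMn z n (k : nat) : expgz z n ^+ k = expgz z (n * k%:Z)%R.
Proof.
elim: k => [|k IH]; first by rewrite mulr0.
by rewrite expgS IH -expgzD; congr expgz; lia.
Qed.

Lemma commute_expgz x y n : commute x y -> commute x (expgz y n).
Proof. by case: n => n xy /=; [|apply: commuteV]; apply: commuteX. Qed.

Lemma commute_expgz2 z m n : commute (expgz z m) (expgz z n).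
Proof. by rewrite /commute -!expgzD addrC. Qed.

Lemma expgz_conj z h n : expgz z n ^ h = expgz (z ^ h) n.
Proof. by case: n => n; rewrite /= ?conjVg conjXg. Qed.

Lemma commute_conj x y h : commute x y -> commute (x ^ h) (y ^ h).
Proof. by rewrite /commute -!conjMg => ->. Qed.

Lemma cyclic_subgroup_commute (C : set G) x y :
  cyclic_subgroup C -> C x -> C y -> commute x y.
Proof. by case=> z -> [m _ <-] [n _ <-]; apply: commute_expgz2. Qed.

End IntegerPowers.

(** * Commuting words *)

Section Words.
Variable T : eqType.
Implicit Types (v w x t : seq T) (n : nat).

Definition word_pow n t := flatten (nseq n t).

Lemma size_word_pow n t : size (word_pow n t) = (n * size t)%N.
Proof. by elim: n => //= n IH; rewrite size_cat [in LHS]IH mulSn. Qed.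

Lemma word_pow_commute n x w :
  x ++ w = w ++ x -> word_pow n x ++ w = w ++ word_pow n x.
Proof.
move=> xw; elim: n => [|n IH] /=; first by rewrite cats0.
by rewrite -catA IH catA xw -catA.
Qed.

(** Both [v] and [w] are prefixes of a large power of [x], because they commute
    with it; hence the shorter one is a prefix of the longer one. *)
Lemma commute_word_prefix x v w : x != [::] -> x ++ v = v ++ x ->
  x ++ w = w ++ x -> (size v <= size w)%N -> v = take (size v) w.
Proof.
move=> x0 xv xw vw.
have x_gt0 : (0 < size x)%N by case: (x) x0.
pose p := word_pow (size w) x.
have takeE y : (size y <= size w)%N -> x ++ y = y ++ x -> take (size y) p = y.
  move=> yw /(word_pow_commute (size w)); rewrite -/p.
  move=> /(congr1 (take (size y))); rewrite takel_cat ?take_size_cat //.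
  by rewrite size_word_pow; nia.
by rewrite -{1}(takeE v) // -{1}(takeE w) // take_takel.
Qed.

(** The root is a shortest nonempty word commuting with [x]: it is a prefix of
    every other nonempty word commuting with [x], and what remains after
    removing it still commutes with [x]. *)
Lemma commute_word_root x : x != [::] ->
  exists t, x ++ t = t ++ x /\
    forall w, x ++ w = w ++ x -> exists n, w = word_pow n t.
Proof.
move=> x0.
pose P n := `[<exists t, [/\ t != [::], size t = n & x ++ t = t ++ x]>].
have exP : exists n, P n by exists (size x); apply/asboolP; exists x.
case: (ex_minnP exP) => _ /asboolP[t [t0 <- xt]] t_min.
exists t; split=> // w.
have [n] := ubnP (size w); elim: n w => // n IH w wn xw.
have [->|w0] := eqVneq w [::]; first by exists 0.
have tw : (size t <= size w)%N by apply: t_min; apply/asboolP; exists w.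
have wE : w = t ++ drop (size t) w.
  by rewrite {1}(commute_word_prefix x0 xt xw tw) cat_take_drop.
have t_gt0 : (0 < size t)%N by case: (t) t0.
case: (IH (drop (size t) w)) => [||m dE].
- by rewrite size_drop; lia.
- move/eqP: xw; rewrite wE drop_size_cat // catA xt -!catA.
  by rewrite eqseq_cat // eqxx => /eqP.
- by exists m.+1; rewrite wE dE.
Qed.

End Words.

(** * Reduced words and centralizers in a free group *)

Section FreeGroupWords.
Variable A : choiceType.
Local Open Scope group_scope.
Implicit Types (v w : seq (letter A)) (l m : letter A) (x y z h : free_group A).

Lemma letter_inv_neq l : l != letter_inv l.
Proof. by case: l => a b; rewrite xpair_eqE eqxx /=; case: b. Qed.

Lemma reduced_val x : reduced (val x).
Proof. exact: valP x. Qed.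

(** Reducedness of a concatenation is decided at the junction only. *)
Lemma reduced_join v w l m : reduced (rcons v l ++ m :: w) =
  [&& reduced (rcons v l), m != letter_inv l & reduced (m :: w)].
Proof. by case: v => [//|a v]; rewrite /reduced /= cat_path last_rcons. Qed.

Lemma reduced_glue v w w' : w != [::] ->
  reduced (v ++ w) -> reduced (w ++ w') -> reduced (v ++ w ++ w').
Proof.
case: w => [//|m w] _; case: (lastP v) => [//|{}v l].
by rewrite cat_cons !reduced_join => /and3P[-> -> _] ->.
Qed.

Lemma reduced_word_inv w : reduced w -> reduced (word_inv w).
Proof.
rewrite /reduced /word_inv rev_sorted sorted_map; apply: sub_sorted => l m /=.
by rewrite letter_invK eq_sym.
Qed.

Lemma val_fgrpV x : val x^-1 = word_inv (val x).
Proof. by rewrite /= reduce_id // reduced_word_inv // reduced_val. Qed.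

Lemma val_fgrpM x y :
  reduced (val x ++ val y) -> val (x * y) = val x ++ val y.
Proof. by move=> /reduce_id. Qed.

Lemma size_push l w : (size (push l w) <= (size w).+1)%N.
Proof. by case: w => //= m w; case: ifP => //= _; lia. Qed.

Lemma size_reduce w : (size (reduce w) <= size w)%N.
Proof.
by elim: w => //= l w IH; apply: leq_trans (size_push _ _) _; rewrite ltnS.
Qed.

(** A word which is not reduced loses letters under reduction, so a product
    whose length is the sum of the lengths involves no cancellation. *)
Lemma reduce_size_eq w : size (reduce w) = size w -> reduced w.
Proof.
suff E : size (reduce w) = size w -> reduce w = w.
  by move=> /E <-; apply: reduced_reduce.
elim: w => //= l w IH; rewrite -/(reduce w) => sz.
have szw : size (reduce w) = size w.
  by have := size_push l (reduce w); have := size_reduce w; lia.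
move: sz; rewrite (IH szw); case: (w) => //= m w'.
by case: ifP => //= _; lia.
Qed.

Definition fgrp_size x := size (val x).

Lemma fgrp_sizeV x : fgrp_size x^-1 = fgrp_size x.
Proof. by rewrite /fgrp_size val_fgrpV size_rev size_map. Qed.

Lemma fgrp_sizeM x y : (fgrp_size (x * y)%g <= fgrp_size x + fgrp_size y)%N.
Proof. by rewrite /fgrp_size -size_cat; apply: size_reduce. Qed.

Lemma fgrp_sizeM_eq x y : fgrp_size (x * y) = (fgrp_size x + fgrp_size y)%N ->
  reduced (val x ++ val y).
Proof. by rewrite /fgrp_size -size_cat => /reduce_size_eq. Qed.

Lemma fgrp_size_gt0 x : x != 1 -> (0 < fgrp_size x)%N.
Proof.
by rewrite lt0n; apply: contra => /nilP x0; apply/eqP/val_inj; rewrite x0.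
Qed.

Lemma fgrp_of_word_val x : fgrp_of_word (val x) = x.
Proof. by apply: val_inj; rewrite /= reduce_id // reduced_val. Qed.

Lemma fgrp_of_word_cat v w :
  fgrp_of_word (v ++ w) = fgrp_of_word v * fgrp_of_word w.
Proof. by apply: val_inj; rewrite /= reduce_catl reduce_catr. Qed.

Lemma fgrp_of_word_pow n w : fgrp_of_word (word_pow n w) = fgrp_of_word w ^+ n.
Proof.
by elim: n => [|n IH]; [apply: val_inj | rewrite expgS fgrp_of_word_cat IH].
Qed.

Definition cyc_reduced x := reduced (val x ++ val x).

(** A reduced word which is not cyclically reduced ends with the inverse of
    its first letter; conjugating by that letter shortens it. *)
Lemma conj_cyc_reduced x : exists p, cyc_reduced (x ^ p).
Proof.
have [n] := ubnP (fgrp_size x); elim: n x => // n IH x xn.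
case E : (reduced (val x ++ val x)); first by exists 1; rewrite conjg1.
have rx := reduced_val x.
case Ex : (val x) (E) (rx) => [//|l w].
case: (lastP w) Ex => [|{}w m] Ex; first by rewrite /reduced /= letter_inv_neq.
rewrite -rcons_cons reduced_join => + rw; rewrite rw /= andbT => /negbFE/eqP lm.
pose p := fgrp_of_word [:: l].
have xE : x = p * fgrp_of_word w * p^-1.
  have -> : p^-1 = fgrp_of_word [:: m].
    apply: mulg1_eq; rewrite -fgrp_of_word_cat.
    by apply: val_inj; rewrite /= lm letter_invK eqxx.
  rewrite -(fgrp_of_word_cat [:: l]) -fgrp_of_word_cat -catA cats1.
  by rewrite -[LHS]fgrp_of_word_val Ex.
have xpE : x ^ p = fgrp_of_word w by rewrite xE conjgE mulgVK mulKg.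
case: (IH (x ^ p)) => [|q qP].
  rewrite xpE; apply: leq_ltn_trans (size_reduce w) _.
  by move: xn; rewrite /fgrp_size Ex /= size_rcons; lia.
by exists (p * q); rewrite conjgM.
Qed.

Lemma cyc_reducedXn x n :
  cyc_reduced x -> fgrp_size (x ^+ n) = (n * fgrp_size x)%N.
Proof.
move=> cx; have [x1|x0] := eqVneq (val x) [::].
  have -> : x = 1 by apply: val_inj; rewrite x1.
  by rewrite expg1n muln0.
suff /reduce_id E : reduced (word_pow n (val x)).
  rewrite -[x in LHS]fgrp_of_word_val -fgrp_of_word_pow /fgrp_size /= E.
  exact: size_word_pow.
elim: n => [//|[|n] IH]; first by rewrite /word_pow /= cats0 reduced_val.
exact: reduced_glue.
Qed.

(** Cancellation in x y means that y starts with the inverse of the last letter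
    of x; cancellation in y^-1 x means that y starts with the first letter of
    x. Both together would make x x cancel. *)
Lemma cyc_reduced_join x y : cyc_reduced x ->
  reduced (val x ++ val y) \/ reduced (val y^-1 ++ val x).
Proof.
rewrite val_fgrpV /cyc_reduced.
have := reduced_val y; have := reduced_val x.
case: (val x) => [|f v]; first by left.
case: (val y) => [|m w]; first by right.
have joinE m' w' : reduced ((f :: v) ++ m' :: w') =
    [&& reduced (f :: v), m' != letter_inv (last f v) & reduced (m' :: w')].
  by rewrite (lastI f v) reduced_join.
rewrite !joinE => rv rw /and3P[_ fl _]; rewrite rv rw andbT /=.
have [ml|] := eqVneq m (letter_inv (last f v)); last by left.
rewrite -ml in fl; right.
rewrite /word_inv /= rev_cons reduced_join rv letter_invK fl !andbT.
by rewrite -rev_cons; apply: (reduced_word_inv (w := m :: w)).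
Qed.

(** If x y is computed without cancellation then so is y x, by comparing
    lengths, and the equality of x y and y x holds between plain words. *)
Lemma commute_val x y : commute x y -> reduced (val x ++ val y) ->
  val x ++ val y = val y ++ val x.
Proof.
move=> xy rxy; rewrite -(val_fgrpM rxy) xy val_fgrpM //.
apply: fgrp_sizeM_eq; rewrite -xy addnC.
by rewrite /fgrp_size val_fgrpM // size_cat.
Qed.

(** The generator is given by the root of the word of [x]. An element
    commuting with [x] is a power of it when the product with [x] does not
    cancel; otherwise its inverse is. *)
Lemma cyc_reduced_centralizer x : cyc_reduced x -> x != 1 ->
  exists t, forall y, commute x y <-> range (expgz t) y.
Proof.
move=> cx x1; have vx0 : val x != [::].
  by rewrite -size_eq0 -lt0n; apply: fgrp_size_gt0.
have [w [xw wP]] := commute_word_root vx0.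
pose t := fgrp_of_word w.
have powP y : val x ++ val y = val y ++ val x -> exists n, y = t ^+ n.
  by case/wP=> n yE; exists n; rewrite -fgrp_of_word_pow -yE fgrp_of_word_val.
exists t => y; split=> [xy|[n _ <-]]; last first.
  apply: commute_expgz; rewrite /commute -[x]fgrp_of_word_val.
  by rewrite -!fgrp_of_word_cat xw.
case: (cyc_reduced_join y cx) => r.
  by have [n ->] := powP _ (commute_val xy r); exists (Posz n).
have yx : commute y^-1 x by apply/commute_sym/commuteV.
have [n yE] := powP _ (esym (commute_val yx r)).
by exists (- n%:Z)%R => //; rewrite expgzN /= -yE invgK.
Qed.

(** Centralizers are transported by conjugation, which reduces the claim to a
    cyclically reduced [x]. *)
Lemma fgrp_centralizer_cyclic x : x != 1 ->
  exists t, forall y, commute x y <-> range (expgz t) y.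
Proof.
move=> x1; have [p cx] := conj_cyc_reduced x.
have [|t tP] := cyc_reduced_centralizer cx; first by rewrite conjg_eq1.
exists (t ^ p^-1) => y; split=> [xy|[n _ <-]].
  have /tP [n _ yE] := commute_conj p xy.
  by exists n => //; rewrite -expgz_conj yE conjgK.
rewrite -[x](conjgK p) -expgz_conj; apply: commute_conj.
by apply/tP; exists n.
Qed.

(** Commutation is transitive on nontrivial elements, since centralizers are
    abelian. *)
Lemma fgrp_commute_trans y x z :
  y != 1 -> commute x y -> commute y z -> commute x z.
Proof.
move=> y1 /commute_sym xy yz; have [t tP] := fgrp_centralizer_cyclic y1.
have [m _ <-] : range (expgz t) x by apply/tP.
have [n _ <-] : range (expgz t) z by apply/tP.
exact: commute_expgz2.
Qed.

Lemma fgrp_size_conj x h :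
  (fgrp_size (x ^ h)%g <= fgrp_size x + 2 * fgrp_size h)%N.
Proof.
rewrite conjgE; apply: leq_trans (fgrp_sizeM _ _) _; rewrite fgrp_sizeV.
by move: (fgrp_sizeM x h) => le_xh; rewrite mulSn mul1n addnCA leq_add2l.
Qed.

(** The slope [t] is the translation length of [x], that is, the length of a
    cyclically reduced conjugate; the error [c] is due to conjugation. *)
Lemma fgrp_sizeXn_linear x : x != 1 -> exists t c, (0 < t)%N /\
  forall n, (fgrp_size (x ^+ n)%g <= n * t + c /\
             n * t <= fgrp_size (x ^+ n)%g + c)%N.
Proof.
move=> x1; have [p cx] := conj_cyc_reduced x.
exists (fgrp_size (x ^ p)%g), (2 * fgrp_size p)%N; split.
  by apply: fgrp_size_gt0; rewrite conjg_eq1.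
move=> n; rewrite -cyc_reducedXn // -conjXg; split; last exact: fgrp_size_conj.
rewrite -{1}(conjgK p (x ^+ n)) -(fgrp_sizeV p); exact: fgrp_size_conj.
Qed.

Lemma fgrp_torsion_free x n : x != 1 -> (0 < n)%N -> x ^+ n != 1.
Proof.
move=> x1 n0; apply/eqP=> xn; have [t [c [t0 /(_ (n * c.+1)%N)[_]]]] :=
  fgrp_sizeXn_linear x1.
by rewrite expgnA xn expg1n add0n; nia.
Qed.

Lemma fgrp_sizeXz z (m : int) : fgrp_size (expgz z m) = fgrp_size (z ^+ `|m|%N).
Proof. by case: m => m //=; rewrite fgrp_sizeV. Qed.

(** Conjugating by [h] the equation raised to the power N, the lengths of the
    two sides differ by a constant while their main terms are |m| N t and
    |n| N t. *)
Lemma conj_expgz_le z h (m n : int) : z != 1 ->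
  expgz z m ^ h = expgz z n -> (`|m| <= `|n|)%N.
Proof.
move=> z1 mn; have [t [c [t0 zP]]] := fgrp_sizeXn_linear z1.
rewrite leqNgt; apply/negP => nm.
(* Large enough for N t to exceed the sum of the length errors: c for each
   side and twice the length of h for the conjugation. *)
pose N := (2 * c + 2 * fgrp_size h).+1.
have : expgz z m ^+ N = (expgz z n ^+ N) ^ h^-1 by rewrite conjXg -mn conjgK.
rewrite !expgzMn => mnN.
have : (fgrp_size (z ^+ (`|m| * N)%N) <=
        fgrp_size (z ^+ (`|n| * N)%N) + 2 * fgrp_size h)%N.
  rewrite -!(abszM _ (Posz N)) -!fgrp_sizeXz mnN -(fgrp_sizeV h).
  exact: fgrp_size_conj.
have [_] := zP (`|m| * N)%N; have [+ _] := zP (`|n| * N)%N.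
have : (`|n| * N * t + N * t <= `|m| * N * t)%N.
  by rewrite -!mulnA -mulSnr leq_mul2r nm orbT.
have : (N <= N * t)%N by rewrite leq_pmulr.
by move: (N * t)%N (`|n| * N * t)%N (`|m| * N * t)%N (fgrp_size (z ^+ _)%g)
  (fgrp_size (z ^+ _)%g) => *; lia.
Qed.

(** By comparison of lengths in both directions n = m or n = - m. In the first
    case [h] commutes with z^m; in the second its square does, and [h] follows
    by transitivity through that square, nontrivial for lack of torsion. *)
Lemma conj_expgz_commute z h (m n : int) : z != 1 -> m != 0%R ->
  expgz z m ^ h = expgz z n -> commute h z.
Proof.
move=> z1 m0 mn.
have zm1 : expgz z m != 1.
  case: (m) m0 => k k0 /=; last rewrite invg_eq1.
    by apply: fgrp_torsion_free => //; rewrite lt0n.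
  exact: fgrp_torsion_free.
suff hm : commute h (expgz z m).
  apply: fgrp_commute_trans zm1 hm _.
  exact/commute_sym/commute_expgz.
have nm : expgz z n ^ h^-1 = expgz z m by rewrite -mn conjgK.
have : `|m|%N = `|n|%N.
  by apply/eqP; rewrite eqn_leq (conj_expgz_le z1 mn) (conj_expgz_le z1 nm).
have conj_commute g x : x ^ g = x -> commute g x.
  by move=> xg; rewrite /commute (conjgC x) xg.
move=> absE; have [nE|nE] : (n = m \/ n = - m)%R by lia.
  by apply: conj_commute; rewrite mn nE.
have [->|h1] := eqVneq h 1; first exact/commute_sym/commute1.
have h2 : commute (h ^+ 2) (expgz z m).
  apply: conj_commute; rewrite expg2 conjgM mn nE expgzN conjVg mn nE expgzN.
  exact: invgK.
apply: fgrp_commute_trans h2; first exact: fgrp_torsion_free.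
exact: commuteX.
Qed.

End FreeGroupWords.

(** * Centralizers in a group algebra *)

Lemma seq_maximal (T : eqType) (R : T -> T -> Prop) (s : seq T) (x : T) :
  (forall y, ~ R y y) -> (forall x y z, R x y -> R y z -> R x z) ->
  x \in s ->
  exists m, [/\ m \in s, m = x \/ R x m & forall y, y \in s -> ~ R m y].
Proof.
move=> Rirr Rtr xs.
suff [m [ms mx mP]] : exists m,
    [/\ m \in x :: s, m = x \/ R x m & forall y, y \in s -> ~ R m y].
  exists m; split=> //; move: ms; rewrite inE => /orP[/eqP->|] //.
elim: s {xs} => [|a s [m [ms mx mP]]].
  by exists x; rewrite mem_head; split; [|left|].
have [ma|nma] := pselect (R m a).
  exists a; split; first by rewrite !inE eqxx orbT.
    by right; case: mx => [<-//|xm]; apply: Rtr xm ma.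
  move=> y; rewrite inE => /orP[/eqP->|ys]; first exact: Rirr.
  by move=> ay; apply: (mP y ys); apply: Rtr ma ay.
exists m; split=> //.
  by move: ms; rewrite !inE => /orP[->//|->]; rewrite !orbT.
by move=> y; rewrite inE => /orP[/eqP->|/mP].
Qed.

Section GroupAlgebraCentralizer.
Variables (R : idomainType) (G : groupType).
Local Open Scope ring_scope.
Local Notation kG := (group_algebra R G).
Implicit Types (u v : kG) (g h x z : G).

Lemma mcoeff_galgMl u v x :
  (u * v)@_x = \sum_(g <- msupp u) u@_g * v@_(g^-1 * x)%g.
Proof.
elim/galg_ind: v => [b h|v v' IH IH']; last first.
  rewrite mulrDr mcoeffD IH IH' -big_split /=.
  by apply: eq_bigr => g _; rewrite mcoeffD mulrDr.
rewrite {1}[u]monalgE mulr_suml raddf_sum; apply: eq_bigr => g _.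
rewrite [_ * _ : kG]galg_mulUU /= !mcoeffU mulrnAr; congr (_ *+ nat_of_bool _).
by apply/eqP/eqP => [<-|->]; rewrite ?mulKg ?mulVKg.
Qed.

Lemma mcoeff_galgMr u v x :
  (v * u)@_x = \sum_(g <- msupp u) v@_(x * g^-1)%g * u@_g.
Proof.
elim/galg_ind: v => [b h|v v' IH IH']; last first.
  rewrite mulrDl mcoeffD IH IH' -big_split /=.
  by apply: eq_bigr => g _; rewrite mcoeffD mulrDl.
rewrite {1}[u]monalgE mulr_sumr raddf_sum; apply: eq_bigr => g _.
rewrite [_ * _ : kG]galg_mulUU /= !mcoeffU mulrnAl; congr (_ *+ nat_of_bool _).
by apply/eqP/eqP => [<-|->]; rewrite ?mulgK ?mulgVK.
Qed.

Lemma galg_nonscalar_supp u :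
  ~ galg_scalars u -> exists2 g, g \in msupp u & g != 1%g.
Proof.
move=> nu; apply: contrapT => no; apply: nu; exists u@_1%g => //.
apply/malgP => g; rewrite mcoeffZ mcoeffU.
have [<-|g1] := eqVneq; first by rewrite mulr1.
rewrite mulr0; apply/esym/mcoeff_outdom/negP => gu; apply: no; exists g => //.
by rewrite eq_sym.
Qed.

Lemma galg_spanP (Z : set G) v : galg_span R Z v <-> galg_supp v `<=` Z.
Proof.
split=> [[s [sZ ->]] g|vZ].
  rewrite /galg_supp /= -mcoeff_neq0 raddf_sum /= => sum0.
  apply: contrapT => nZg; move/eqP: sum0; apply.
  rewrite big_seq big1 // => p ps.
  rewrite mcoeffZ mcoeffU; case: eqP => [pg|]; last by rewrite mulr0.
  by case: nZg; rewrite -pg; apply: sZ.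
exists [seq (v@_g, g) | g <- msupp v].
split=> [_ /mapP[g gv ->]|]; first exact: vZ.
rewrite {1}[v]monalgE big_map; apply: eq_bigr => g _.
by rewrite galg_scaleU mulr1.
Qed.

Lemma galg_commute_supp u v :
  (forall g h, g \in msupp u -> h \in msupp v -> commute g h) -> u * v = v * u.
Proof.
move=> uv; rewrite [u]monalgE [v]monalgE mulr_suml mulr_sumr.
rewrite big_seq [RHS]big_seq; apply: eq_bigr => g gu.
rewrite mulr_sumr mulr_suml big_seq [RHS]big_seq; apply: eq_bigr => h hv.
by rewrite ![_ * _ : kG]galg_mulUU uv // mulrC.
Qed.

(** For z of infinite order this says that <z> x <z> acts freely, by left and
    right translations, on the complement of <z>: the case i < 0 follows by
    moving the powers of z to the other side. *)
Definition free_biaction z := forall h (i : nat) (j : int), (0 < i)%N ->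
  (z ^+ i * h * expgz z j = h)%g -> range (expgz z) h.

(** Comparison of the coefficients of u v and v u at M h, where M = z^N is the
    top term of [u] and h is an element of the support of [v] outside <z> with
    no element z^i h z^j, i > 0, above it in that support. Only M and h
    contribute to u v there, while a contribution to v u would put some
    z^N h z^-n in the support of [v]. *)
Lemma centralizer_supp_pos z u v (n : nat) :
  free_biaction z -> galg_supp u `<=` range (expgz z) ->
  (0 < n)%N -> (z ^+ n)%g \in msupp u -> u * v = v * u ->
  galg_supp v `<=` range (expgz z).
Proof.
move=> zP uZ n0 zn uv h0 h0v; apply: contrapT => nZh0.
pose above x y := exists2 i : nat, (0 < i)%N & (y = z ^+ i * x)%g.
have [||M [Mu nM Mmax]] := seq_maximal (R := above) _ _ zn.
(* If z had finite order, freeness with j = 0 would put h0 in <z>. *)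
- move=> y [i i0 yE]; apply: nZh0; apply: (zP _ i 0%R) => //.
  move/(congr1 (fun t => t * y^-1 * h0)%g): yE.
  by rewrite mulgV mulgK mul1g mulg1.
- move=> x y t [i i0 ->] [j j0 ->]; exists (j + i)%N.
    by rewrite addn_gt0 j0.
  by rewrite expgnDr mulgA.
have {nM} [N N0 ME] : exists2 N : nat, (0 < N)%N & M = (z ^+ N)%g.
  case: nM => [->|[i i0 ->]]; first by exists n.
  by exists (i + n)%N; rewrite ?expgnDr // addn_gt0 i0.
pose dabove x y := ~ range (expgz z) x /\
  exists (i : nat) (j : int), (0 < i)%N /\ (y = z ^+ i * x * expgz z j)%g.
have [||h [hv nh hmax]] := seq_maximal (R := dabove) _ _ h0v.
- by move=> y [nZ [i [j [i0 yE]]]]; apply: nZ; apply: zP i0 (esym yE).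
- move=> x y t [nZ [i [j [i0 ->]]]] [_ [i' [j' [i'0 ->]]]]; split=> //.
  exists (i' + i)%N, (j + j')%R; split; first by rewrite addn_gt0 i0 orbT.
  by rewrite expgnDr expgzD !mulgA.
have nZh : ~ range (expgz z) h.
  case: nh => [->//|[_ [i [j [i0 ->]]]] [m _ mE]]; apply: nZh0.
  exists (- i%:Z + m - j)%R => //.
  by rewrite !expgzD !expgzN mE /= !mulgA mulVg mul1g mulgK.
have : (u * v)@_(M * h)%g != 0.
  rewrite mcoeff_galgMl (bigD1_seq M Mu (fset_uniq _)) /=.
  rewrite big1_seq => [|g /andP[gM gu]].
    by rewrite addr0 mulKg mulf_neq0 // mcoeff_neq0.
  (* Another term z^m of u pairs with z^(N - m) h: above h if m < N, while
     m > N contradicts the choice of M. *)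
  have [m _ mE] := uZ g gu.
  have [mN|Nm] := ltP m N%:Z.
    rewrite (@mcoeff_outdom _ _ v) ?mulr0 //; apply/negP => /hmax; apply.
    split=> //; exists `|N%:Z - m|%N, 0%R; split; first lia.
    rewrite mulg1 mulgA; congr (_ * _)%g.
    rewrite -[LHS](_ : expgz z (- m + N%:Z) = _)%g; last first.
      by rewrite expgzD expgzN mE ME.
    by rewrite -[RHS]/(expgz z `|N%:Z - m|%N); congr expgz; lia.
  have Nm' : (N%:Z < m)%R.
    rewrite lt_neqAle Nm andbT; apply: contra gM => /eqP mN.
    by rewrite -mE -mN ME.
  case: (Mmax g gu); exists `|m - N%:Z|%N; first lia.
  rewrite -mE ME -[(z ^+ N)%g]/(expgz z N).
  rewrite -[(z ^+ _)%g]/(expgz z `|m - N%:Z|%N).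
  by rewrite -expgzD; congr expgz; lia.
rewrite uv mcoeff_galgMr big1_seq ?eqxx // => g gu.
rewrite mcoeff_outdom ?mul0r //; apply/negP => /hmax; apply; split=> //.
have [m _ mE] := uZ g gu.
by exists N, (- m)%R; split; rewrite // expgzN mE ME.
Qed.

Lemma range_expgzV z : range (expgz z^-1%g) = range (expgz z).
Proof.
by apply/seteqP; split=> _ [n _ <-]; exists (- n)%R => //;
  rewrite expgzN expgzV ?invgK.
Qed.

(** The nontrivial element [g] is a positive power of z or of z^-1, and the
    hypotheses are symmetric in these two generators of <z>. *)
Lemma centralizer_supp z u v g :
  free_biaction z -> galg_supp u `<=` range (expgz z) ->
  g \in msupp u -> g != 1%g -> u * v = v * u ->
  galg_supp v `<=` range (expgz z).
Proof.
move=> zP uZ gu g1 uv; have [[[|n]|n] _ gE] := uZ g gu.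
- by rewrite -gE eqxx in g1.
- by rewrite -gE in gu; apply: (@centralizer_supp_pos z u v n.+1) uv.
rewrite -range_expgzV; apply: (@centralizer_supp_pos _ u v n.+1) uv => //.
- move=> h i j i0 /(congr1 (fun t => z ^+ i * t * expgz z j)%g).
  rewrite range_expgzV expVgn expgzV !mulgA mulgV mul1g mulgVK => hE.
  exact: zP i0 (esym hE).
- by rewrite range_expgzV.
by rewrite expVgn; move: gu; rewrite -gE.
Qed.

End GroupAlgebraCentralizer.

Theorem corollary6p3 (k : fieldType) (A : finType)
    (u : group_algebra k (free_group A)) :
  ~ galg_scalars u ->
  supported_on_cyclic u ->
  exists Z : set (free_group A),
    largest_cyclic_containing (galg_supp u) Z /\
    centralizer u = galg_span k Z.
Proof.
move=> /galg_nonscalar_supp[g gu g1] [C [cycC uC]].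
have [z zP] := fgrp_centralizer_cyclic g1.
have cycZ : cyclic_subgroup (range (expgz z)) by exists z.
have uZ : galg_supp u `<=` range (expgz z).
  by move=> x xu; apply/zP; apply: cyclic_subgroup_commute cycC _ _; apply: uC.
have gz : commute g z by apply/zP; exists 1.
have z1 : z != 1%g.
  apply: contra g1 => /eqP z1; have [n _ <-] := uZ g gu.
  by rewrite z1; case: n => n /=; rewrite expg1n ?invg1.
have z_free : free_biaction z.
  move=> h i j i0 hE; apply/zP.
  apply: (fgrp_commute_trans z1 gz); apply: commute_sym.
  apply: (@conj_expgz_commute _ z h i (- j)%R) => //; first lia.
  by rewrite conjgE expgzN -{1}hE !invgM !mulgA !mulgVK.
exists (range (expgz z)); split.
  split=> // D cycD uD x Dx; apply/zP.
  by apply: cyclic_subgroup_commute cycD _ Dx; apply: uD.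
apply/seteqP; split=> v; rewrite galg_spanP; [move=> uv|move=> vZ].
  exact: centralizer_supp z_free uZ gu g1 uv.
apply: galg_commute_supp => x y xu yv.
exact: cyclic_subgroup_commute cycZ (uZ _ xu) (vZ _ yv).
Qed.
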